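(* Let $A$ and $B$ be two asynchronously composable IOTSes such that at least one of the following conditions holds: (1) $A\otimes_{as}B$ satisfies property $\mathcal{P}$; (2) $A\otimes_{as}B$ is half-duplex; (3) for each $(s_A,s_B)\in\mathit{reach}(A\otimes B)$ and all transitions $s_A\xrightarrow{a}_A s_A'$, $s_B\xrightarrow{b}_B s_B'$, either $a\notin\mathit{out}_A\cap\mathit{in}_B$ or $b\notin\mathit{out}_B\cap\mathit{in}_A$. Then: (1) if $A$ and $B$ are strongly synchronously compatible, then $A$ and $B$ are strongly asynchronously compatible; (2) if $A$ and $B$ are weakly synchronously compatible, then $A$ and $B$ are weakly asynchronously compatible.
   Context: An I/O-transition system (IOTS) is a quadruple $A=(\mathit{states}_A,\mathit{start}_A,\mathit{act}_A,\to_A)$ with a set of states, an initial state, a set of actions $\mathit{act}_A=\mathit{in}_A\cup\mathit{out}_A\cup\mathit{int}_A$ (disjoint union of input, output and internal actions), and a transition relation $\to_A\subseteq\mathit{states}_A\times\mathit{act}_A\times\mathit{states}_A$; write $s\xrightarrow{a}_A s'$. For $X\subseteq\mathit{act}_A$, $s\ (\xrightarrow{X})^*_A\ s'$ means a (possibly empty) finite sequence of transitions from $s$ to $s'$ labelled by actions in $X$. $\mathit{reach}(A)$ is the set of states reachable from $\mathit{start}_A$. $A,B$ are composable if $\mathit{act}_A\cap\mathit{act}_B=(\mathit{in}_A\cap\mathit{out}_B)\cup(\mathit{in}_B\cap\mathit{out}_A)=:\mathit{shared}(A,B)$. The synchronous composition $A\otimes B$ has states $\mathit{states}_A\times\mathit{states}_B$,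 initial state $(\mathit{start}_A,\mathit{start}_B)$, inputs $(\mathit{in}_A\cup\mathit{in}_B)\setminus\mathit{shared}(A,B)$, outputs $(\mathit{out}_A\cup\mathit{out}_B)\setminus\mathit{shared}(A,B)$, internal actions $\mathit{int}_A\cup\mathit{int}_B\cup\mathit{shared}(A,B)$; its transitions: a non-shared action of $A$ (resp. $B$) moves only the $A$ (resp. $B$) component according to a transition of $A$ (resp. $B$); a shared action $a$ gives $(s,t)\xrightarrow{a}(s',t')$ when $s\xrightarrow{a}_A s'$ and $t\xrightarrow{a}_B t'$. For a set $M$ let $M^\rhd=\{a^\rhd\mid a\in M\}$ (fresh names). The queue IOTS $Q_M$ has states $M^*$, initial state $\epsilon$, inputs $M^\rhd$, outputs $M$, no internal actions, transitions $q\xrightarrow{a^\rhd}qa$ and $aq\xrightarrow{a}q$. For $M\subseteq\mathit{out}_A$ with $M^\rhd\cap\mathit{act}_A=\emptyset$, $A^\rhd_M$ is $A$ with each $a\in M$ renamed to $a^\rhd$, and $\Omega_M(A)=A^\rhd_M\otimes Q_M$. $A,B$ are asynchronously composable if composable and $\mathit{shared}(A,B)^\rhd\cap(\mathit{act}_A\cup\mathit{act}_B)=\emptyset$. Let $\mathit{out}_{AB}=\mathit{out}_A\cap\mathit{in}_B$, $\mathit{out}_{BA}=\mathit{out}_B\cap\mathit{in}_A$, $\Omega(A)=\Omega_{\mathit{out}_{AB}}(A)$, $\Omega(B)=\Omega_{\mathit{out}_{BA}}(B)$. $\Omega(A)$ has states $(s,q)$, $q\in\mathit{out}_{AB}^*$,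 inputs $\mathit{in}_A$, outputs $\mathit{out}_A$, internal actions $\mathit{int}_A\cup\mathit{out}_{AB}^\rhd$, transitions $(s,q)\xrightarrow{a}(s',q)$ if $s\xrightarrow{a}_A s'$, $a\notin\mathit{out}_{AB}$; $(s,q)\xrightarrow{a^\rhd}(s',qa)$ if $s\xrightarrow{a}_A s'$, $a\in\mathit{out}_{AB}$; $(s,aq)\xrightarrow{a}(s,q)$ for $a\in\mathit{out}_{AB}$. $\Omega(B)$ analogously. $A\otimes_{as}B=\Omega(A)\otimes\Omega(B)$, initial state $((\mathit{start}_A,\epsilon),(\mathit{start}_B,\epsilon))$. Compatibility: $A,B$ are strongly synchronously compatible if composable and for every $(s_A,s_B)\in\mathit{reach}(A\otimes B)$: for every $a\in\mathit{out}_A\cap\mathit{in}_B$, if $s_A\xrightarrow{a}_A s_A'$ for some $s_A'$ then $s_B\xrightarrow{a}_B s_B'$ for some $s_B'$; and symmetrically for $b\in\mathit{out}_B\cap\mathit{in}_A$ with roles of $A,B$ exchanged. They are weakly synchronously compatible if composable and for every reachable $(s_A,s_B)$ and $a\in\mathit{out}_A\cap\mathit{in}_B$ with $s_A\xrightarrow{a}_A s_A'$ there exist $\bar s_B,s_B'$ with $s_B\ (\xrightarrow{\mathit{int}_B})^*_B\ \bar s_B\xrightarrow{a}_B s_B'$, and symmetrically (using $\mathit{int}_A$). Asynchronously composable $A,B$ are strongly (weakly) asynchronously compatible if $\Omega(A)$ and $\Omega(B)$ are strongly (weakly) synchronously compatible. $A\otimes_{as}B$ is half-duplex if every reachable state $((s_A,q_A),(s_B,q_B))$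 of $\Omega(A)\otimes\Omega(B)$ has $q_A=\epsilon$ or $q_B=\epsilon$. Property $\mathcal{P}$: with $F_A=\mathit{act}_A\setminus\mathit{shared}(A,B)$, for $a\in\mathit{out}_A\cap\mathit{in}_B$ write $s\Rightarrow^a_A s'$ if $s\ (\xrightarrow{F_A})^*_A\ \bar s\xrightarrow{a}_A\bar s'\ (\xrightarrow{F_A})^*_A\ s'$ for some $\bar s,\bar s'$; $\Rightarrow^b_B$ analogously. $A\otimes_{as}B$ satisfies $\mathcal{P}$ if every reachable state $((s_A,q_A),(s_B,q_B))$ of $\Omega(A)\otimes\Omega(B)$ satisfies one of: (i) $q_A=q_B=\epsilon$ and $(s_A,s_B)\in\mathit{reach}(A\otimes B)$; (ii) $q_A=a_1\ldots a_m\neq\epsilon$, $q_B=\epsilon$, and some $r_A$ has $(r_A,s_B)\in\mathit{reach}(A\otimes B)$ and $r_A\Rightarrow^{a_1}_A\cdots\Rightarrow^{a_m}_A s_A$; (iii) symmetric with $q_A=\epsilon$, $q_B=b_1\ldots b_m\neq\epsilon$, some $r_B$ with $(s_A,r_B)\in\mathit{reach}(A\otimes B)$ and $r_B\Rightarrow^{b_1}_B\cdots\Rightarrow^{b_m}_B s_B$. *)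

(* Defs.v *)
From mathcomp Require Import all_boot boolp classical_sets.
From Stdlib Require Import Relation_Operators.

Set Implicit Arguments.
Unset Strict Implicit.
Unset Printing Implicit Defensive.

Local Open Scope classical_set_scope.

(* All actions live in a common universe [Act], which is any type. An IOTS is
   a [preiots] satisfying [is_iots]; keeping the two apart lets [sync],
   [rename] and [omega] be total operations. They preserve [is_iots] under the
   usual side conditions, see the lemmas at the end of the file. *)
Record preiots (Act : Type) : Type := PreIOTS {
  state : Type;
  start : state;
  inp : set Act;
  out : set Act;
  int : set Act;
  trans : state -> Act -> state -> Prop
}.

Definition act (Act : Type) (A : preiots Act) : set Act :=
  inp A `|` out A `|` int A.

Record is_iots (Act : Type) (A : preiots Act) : Prop := IsIOTS {
  inp_out_disj : inp A `&` out A = set0;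
  inp_int_disj : inp A `&` int A = set0;
  out_int_disj : out A `&` int A = set0;
  trans_act : forall s a s', trans (p := A) s a s' -> act A a
}.

Definition steps (Act : Type) (A : preiots Act) (X : set Act) :
    state A -> state A -> Prop :=
  clos_refl_trans (state A) (fun s s' => exists2 a, X a & trans s a s').

Definition reach (Act : Type) (A : preiots Act) : set (state A) :=
  [set s | steps (act A) (start A) s].
Arguments reach {Act} A _.

Definition shared (Act : Type) (A B : preiots Act) : set Act :=
  (inp A `&` out B) `|` (inp B `&` out A).

Definition composable (Act : Type) (A B : preiots Act) : Prop :=
  act A `&` act B = shared A B.

Definition sync (Act : Type) (A B : preiots Act) : preiots Act := {|
  state := (state A * state B)%type;
  start := (start A, start B);
  inp := (inp A `|` inp B) `\` shared A B;
  out := (out A `|` out B) `\` shared A B;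
  int := int A `|` int B `|` shared A B;
  trans := fun p a p' =>
    [\/ [/\ (act A `\` shared A B) a, trans p.1 a p'.1 & p'.2 = p.2],
        [/\ (act B `\` shared A B) a, p'.1 = p.1 & trans p.2 a p'.2]
      | [/\ shared A B a, trans p.1 a p'.1 & trans p.2 a p'.2]]
|}.

(* Throughout, [rhd a] is the name written a^|> in the literature: [rhd] is an
   injective renaming, and freshness is always stated where it is needed, as
   disjointness of [rhd @` M] from the actions at hand. *)

(* Queue contents are words over the subtype of elements of [M], i.e. M^*. *)
Definition queue (Act : Type) (rhd : Act -> Act) (M : set Act) :
    preiots Act := {|
  state := seq (set_type M);
  start := [::];
  inp := rhd @` M;
  out := M;
  int := set0;
  trans := fun q l q' =>
    (exists2 a : set_type M, l = rhd (\val a) & q' = rcons q a) \/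
    (exists2 a : set_type M, l = \val a & q = a :: q')
|}.

Definition ren (Act : Type) (rhd : Act -> Act) (M : set Act) (a : Act) : Act :=
  if a \in M then rhd a else a.

(* Only meant for M `<=` out A, so that inputs and internal actions are
   unaffected. *)
Definition rename (Act : Type) (rhd : Act -> Act) (M : set Act)
    (A : preiots Act) : preiots Act := {|
  state := state A;
  start := start A;
  inp := inp A;
  out := ren rhd M @` out A;
  int := int A;
  trans := fun s l s' => exists2 a, l = ren rhd M a & trans s a s'
|}.

Definition omega_on (Act : Type) (rhd : Act -> Act) (M : set Act)
    (A : preiots Act) : preiots Act :=
  sync (rename rhd M A) (queue rhd M).

Definition async_composable (Act : Type) (rhd : Act -> Act)
    (A B : preiots Act) : Prop :=
  composable A B /\ (rhd @` shared A B) `&` (act A `|` act B) = set0.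

(* [omega rhd A B] is Omega(A) for the peer B; Omega(B) is [omega rhd B A]. *)
Definition omega (Act : Type) (rhd : Act -> Act) (A B : preiots Act) :
    preiots Act :=
  omega_on rhd (out A `&` inp B) A.

Definition async (Act : Type) (rhd : Act -> Act) (A B : preiots Act) :
    preiots Act :=
  sync (omega rhd A B) (omega rhd B A).

Definition strongly_sync_compatible (Act : Type) (A B : preiots Act) : Prop :=
  composable A B /\
  forall (sA : state A) (sB : state B), reach (sync A B) (sA, sB) ->
    (forall a, (out A `&` inp B) a ->
       (exists sA', trans sA a sA') -> exists sB', trans sB a sB') /\
    (forall b, (out B `&` inp A) b ->
       (exists sB', trans sB b sB') -> exists sA', trans sA b sA').

Definition weakly_sync_compatible (Act : Type) (A B : preiots Act) : Prop :=
  composable A B /\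
  forall (sA : state A) (sB : state B), reach (sync A B) (sA, sB) ->
    (forall a, (out A `&` inp B) a -> (exists sA', trans sA a sA') ->
       exists tB sB', steps (int B) sB tB /\ trans tB a sB') /\
    (forall b, (out B `&` inp A) b -> (exists sB', trans sB b sB') ->
       exists tA sA', steps (int A) sA tA /\ trans tA b sA').

Definition strongly_async_compatible (Act : Type) (rhd : Act -> Act)
    (A B : preiots Act) : Prop :=
  async_composable rhd A B /\
  strongly_sync_compatible (omega rhd A B) (omega rhd B A).

Definition weakly_async_compatible (Act : Type) (rhd : Act -> Act)
    (A B : preiots Act) : Prop :=
  async_composable rhd A B /\
  weakly_sync_compatible (omega rhd A B) (omega rhd B A).

Definition half_duplex (Act : Type) (rhd : Act -> Act) (A B : preiots Act) :
    Prop :=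
  forall (sA : state A) qA (sB : state B) qB,
    reach (async rhd A B) ((sA, qA), (sB, qB)) ->
    qA = [::] \/ qB = [::].

(* [wstep A F a] is the relation ==>^a, with F the set of actions that may
   surround a; [wsteps] iterates it along a word. *)
Definition wstep (Act : Type) (A : preiots Act) (F : set Act) (a : Act)
    (s s' : state A) : Prop :=
  exists t t', [/\ steps F s t, trans t a t' & steps F t' s'].

Fixpoint wsteps (Act : Type) (A : preiots Act) (F : set Act) (w : seq Act)
    (s s' : state A) : Prop :=
  if w is a :: w' then exists2 t, wstep F a s t & wsteps F w' t s'
  else s = s'.

Definition propertyP (Act : Type) (rhd : Act -> Act) (A B : preiots Act) :
    Prop :=
  forall (sA : state A) qA (sB : state B) qB,
    reach (async rhd A B) ((sA, qA), (sB, qB)) ->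
    [\/ [/\ qA = [::], qB = [::] & reach (sync A B) (sA, sB)],
        [/\ qA <> [::], qB = [::] &
            exists2 rA : state A, reach (sync A B) (rA, sB) &
              wsteps (act A `\` shared A B) [seq \val a | a <- qA] rA sA]
      | [/\ qA = [::], qB <> [::] &
            exists2 rB : state B, reach (sync A B) (sA, rB) &
              wsteps (act B `\` shared A B) [seq \val b | b <- qB] rB sB]].

Definition no_mixed_outputs (Act : Type) (A B : preiots Act) : Prop :=
  forall (sA : state A) (sB : state B), reach (sync A B) (sA, sB) ->
    forall a sA' b sB', trans sA a sA' -> trans sB b sB' ->
      ~ (out A `&` inp B) a \/ ~ (out B `&` inp A) b.

Lemma disjP (T : Type) (X Y : set T) :
  X `&` Y = set0 <-> forall a, X a -> Y a -> False.
Proof.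
split=> [E a Xa Ya|H]; first by have : (X `&` Y) a by []; rewrite E.
by rewrite -subset0 => a [Xa Ya]; apply: (H a).
Qed.

Lemma is_iots_sync (Act : Type) (A B : preiots Act) :
  is_iots A -> is_iots B -> composable A B -> is_iots (sync A B).
Proof.
move=> [/disjP a1 /disjP a2 /disjP a3 a4] [/disjP b1 /disjP b2 /disjP b3 b4] c.
have sh a : act A a -> act B a -> shared A B a by move=> ? ?; rewrite -c.
have shA a : shared A B a -> act A a by rewrite -c => -[].
have shB a : shared A B a -> act B a by rewrite -c => -[].
have iA a : inp A a -> act A a by left; left.
have oA a : out A a -> act A a by left; right.
have tA a : int A a -> act A a by right.
have iB a : inp B a -> act B a by left; left.
have oB a : out B a -> act B a by left; right.
have tB a : int B a -> act B a by right.
split.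
- by apply/disjP => a /= [[x|x] n] [[y|y] _]; eauto.
- by apply/disjP => a /= [[x|x] n] [[y|y]|y]; eauto.
- by apply/disjP => a /= [[x|x] n] [[y|y]|y]; eauto.
have key a : act A a \/ act B a -> act (sync A B) a.
  move=> H; have [s|n] := pselect (shared A B a); first by right; right.
  rewrite /act /=; case: H => -[[x|x]|x].
  - by left; left; split => //; left.
  - by left; right; split => //; left.
  - by right; left; left.
  - by left; left; split => //; right.
  - by left; right; split => //; right.
  - by right; left; right.
by move=> s a s' [[[h _] _ _]|[[h _] _ _]|[h _ _]]; apply: key; auto.
Qed.

Lemma is_iots_queue (Act : Type) (rhd : Act -> Act) (M : set Act) :
  (rhd @` M) `&` M = set0 -> is_iots (queue rhd M).
Proof.
move=> h; split; rewrite /= ?setI0 //.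
move=> q l q' [[a -> _]|[a -> _]].
  by left; left; exists (\val a) => //; apply: set_valP.
by left; right; apply: set_valP.
Qed.

Section Omega.
Variables (Act : Type) (rhd : Act -> Act) (A : preiots Act) (M : set Act).
Hypotheses (iA : is_iots A) (MA : M `<=` out A).
Hypothesis fresh : (rhd @` M) `&` act A = set0.

Let renM a : M a -> ren rhd M a = rhd a.
Proof. by rewrite /ren => Ma; rewrite mem_set. Qed.

Let renN a : ~ M a -> ren rhd M a = a.
Proof. by rewrite /ren => Ma; rewrite memNset. Qed.

Lemma out_rename : out (rename rhd M A) = (out A `\` M) `|` (rhd @` M).
Proof.
apply/seteqP; split=> a /=.
  case=> b ob <-; have [Mb|nM] := pselect (M b).
    by rewrite renM //; right; exists b.
  by rewrite renN //; left.
case=> [[oa nM]|[b Mb <-]]; first by exists a => //; rewrite renN.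
by exists b; [apply: MA|rewrite renM].
Qed.

Let fr a : (rhd @` M) a -> act A a -> False.
Proof. by move/disjP: fresh; apply. Qed.

Lemma is_iots_rename : is_iots (rename rhd M A).
Proof.
case: iA => /disjP a1 /disjP a2 /disjP a3 a4; split.
- rewrite out_rename; apply/disjP => a ia [[oa _]|ra]; first exact: (a1 a).
  by apply: (fr ra); left; left.
- exact/disjP.
- rewrite out_rename; apply/disjP => a [[oa _]|ra] ta; first exact: (a3 a).
  by apply: (fr ra); right.
move=> s _ s' [a -> t]; rewrite /act out_rename /=.
have [Ma|nM] := pselect (M a).
  by rewrite renM //; left; right; right; exists a.
rewrite renN //; case: (a4 _ _ _ t) => [[x|x]|x].
- by left; left.
- by left; right; left.
- by right.
Qed.

Let shE : shared (rename rhd M A) (queue rhd M) = rhd @` M.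
Proof.
case: iA => /disjP a1 _ _ _; rewrite /shared out_rename.
apply/seteqP; split=> a /=; first by case=> -[ia]; [move/MA/(a1 _ ia)|].
by move=> ra; right; split=> //; right.
Qed.

Lemma composable_rename_queue : composable (rename rhd M A) (queue rhd M).
Proof.
case: iA => /disjP a1 /disjP a2 /disjP a3 _.
rewrite /composable shE /act out_rename; apply/seteqP; split=> a /=; last first.
  by move=> ra; split; [left; right; right|left; left].
case=> x [[//|Ma]|//]; case: x => [[x|[[_ //]|//]]|x].
  by case: (a1 _ x (MA Ma)).
by case: (a3 _ (MA Ma) x).
Qed.

Lemma is_iots_omega_on : is_iots (omega_on rhd M A).
Proof.
apply: is_iots_sync; [exact: is_iots_rename| |exact: composable_rename_queue].
apply: is_iots_queue; apply/disjP => a ra Ma.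
by apply: (fr ra); left; right; apply: MA.
Qed.

Lemma inp_omega_on : inp (omega_on rhd M A) = inp A.
Proof.
rewrite /= shE; apply/seteqP; split=> a /=; first by case=> -[].
by move=> ia; split; [left|move=> ra; apply: (fr ra); left; left].
Qed.

Lemma out_omega_on : out (omega_on rhd M A) = out A.
Proof.
have -> : out (omega_on rhd M A) = (out (rename rhd M A) `|` M) `\`
  shared (rename rhd M A) (queue rhd M) by [].
rewrite out_rename shE; apply/seteqP; split=> a /=.
  by case=> -[[[]//|//]|/MA].
move=> oa; split; last by move=> ra; apply: (fr ra); left; right.
by have [Ma|nM] := pselect (M a); [right|left; left].
Qed.

Lemma int_omega_on : int (omega_on rhd M A) = int A `|` (rhd @` M).
Proof. by rewrite /= shE setU0. Qed.

Lemma trans_omega_on (rhd_inj : injective rhd)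
    (s s' : state A) q a q' :
  trans (p := omega_on rhd M A) (s, q) a (s', q') <->
  [\/ [/\ ~ M a, trans s a s' & q' = q],
      exists x : set_type M,
        [/\ a = rhd (\val x), trans s (\val x) s' & q' = rcons q x]
    | exists x : set_type M, [/\ a = \val x, s' = s & q = x :: q']].
Proof.
have nr y : act A y -> ~ (rhd @` M) y by move=> h /fr.
have tr := trans_act iA.
have Mact y : M y -> act A y by move=> /MA; left; right.
rewrite /= shE; split.
  case=> [[[_ nra] [y E t] ->]|[[_ nra] -> h]|[ra [y E t] h]].
  - have [My|nM] := pselect (M y).
      by exfalso; apply: nra; rewrite E renM //; exists y.
    by rewrite renN // in E; apply: Or31; rewrite E.
  - case: h => [[x ax _]|[x ax ->]].
      by exfalso; apply: nra; exists (\val x) => //; apply: set_valP.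
    by apply: Or33; exists x.
  - have [My|nM] := pselect (M y); last first.
      by rewrite E renN // in ra; case: (nr _ (tr _ _ _ t) ra).
    rewrite renM // in E; case: h => [[x ax ->]|[x ax _]].
      apply: Or32; exists x; split=> //.
      by rewrite -(rhd_inj y (\val x)) // -E.
    by case: (nr a _ ra); rewrite ax; apply: Mact; apply: set_valP.
have xM (x : set_type M) : M (\val x) by apply: set_valP.
case=> [[nM t ->]|[x [-> t ->]]|[x [-> -> ->]]].
- apply: Or31; split=> //; last by exists a => //; rewrite renN.
  split; last exact: nr (tr _ _ _ t).
  by apply: (trans_act is_iots_rename (s := s) (s' := s')); exists a; rewrite ?renN.
- apply: Or33; split; first by exists (\val x).
    by exists (\val x) => //; rewrite renM.
  by left; exists x.
- apply: Or32; split=> //; last by right; exists x.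
  by split; [left; right; exact: xM|apply: nr; apply: Mact; exact: xM].
Qed.

End Omega.

Lemma composable_omega (Act : Type) (rhd : Act -> Act) (A B : preiots Act) :
  injective rhd -> is_iots A -> is_iots B -> async_composable rhd A B ->
  composable (omega rhd A B) (omega rhd B A).
Proof.
move=> rhd_inj iA iB [c /disjP f].
have MA : out A `&` inp B `<=` out A by move=> a [].
have MB : out B `&` inp A `<=` out B by move=> a [].
have rA a : (rhd @` (out A `&` inp B)) a -> (rhd @` shared A B) a.
  by case=> x [? ?] <-; exists x => //; right.
have rB a : (rhd @` (out B `&` inp A)) a -> (rhd @` shared A B) a.
  by case=> x [? ?] <-; exists x => //; left.
have fA : (rhd @` (out A `&` inp B)) `&` act A = set0.
  by apply/disjP => a /rA ra aa; apply: (f a) => //; left.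
have fB : (rhd @` (out B `&` inp A)) `&` act B = set0.
  by apply/disjP => a /rB ra aa; apply: (f a) => //; right.
have actA : act (omega rhd A B) = act A `|` rhd @` (out A `&` inp B).
  by rewrite /act inp_omega_on // out_omega_on // int_omega_on // setUA.
have actB : act (omega rhd B A) = act B `|` rhd @` (out B `&` inp A).
  by rewrite /act inp_omega_on // out_omega_on // int_omega_on // setUA.
rewrite /composable actA actB /shared !inp_omega_on // !out_omega_on //.
rewrite -/(shared A B) -c; apply/seteqP; split=> a; last first.
  by case=> aA aB; split; left.
case=> -[aA|ra] [aB|rb] //.
- by case: (f a (rB _ rb)); left.
- by case: (f a (rA _ ra)); right.
exfalso; case: ra rb => x [ox _] <- [y [_ iy] /rhd_inj E].
by rewrite E in iy ox; case: iA => /disjP d _ _ _; apply: (d x); rewrite // -E.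
Qed.

(* Main.v *)
Require Import Defs.
From mathcomp Require Import all_boot boolp classical_sets.
From Stdlib Require Import Relation_Operators Operators_Properties.

(** Condition (3) implies P and is implied by half-duplex. For the first
    implication, every reachable asynchronous state arises from a synchronously
    reachable one by letting a single component run ahead by the word still in
    its queue: as long as that word is non-empty, condition (3), applied at the
    state where its first letter is about to be sent, forbids the peer to send.
    For the second, synchronously reachable states are asynchronously reachable
    with empty queues, from which two competing outputs would fill both queues.
    Under P the sender of the head of a queue lags behind a synchronously
    reachable state in which the same message is offered to the same receiver
    state, so synchronous compatibility applies there. *)

Set Implicit Arguments.
Unset Strict Implicit.
Unset Printing Implicit Defensive.

Local Open Scope classical_set_scope.

(** * Runs, reachability, and exchanging the two components *)

Section Runs.
Variable Act : Type.
Implicit Types A B : preiots Act.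

Lemma steps_map A B (X Y : set Act) (f : state A -> state B) s s' :
  (forall s a s', X a -> trans s a s' ->
     exists2 b, Y b & trans (f s) b (f s')) ->
  steps X s s' -> steps Y (f s) (f s').
Proof.
move=> H; elim=> [x y [a Xa t]|x|x y z _ IH1 _ IH2].
- exact/rt_step/(H _ _ _ Xa t).
- exact: rt_refl.
- exact: rt_trans IH1 IH2.
Qed.

Lemma steps_snoc A (X : set Act) (r s s' : state A) a :
  steps X r s -> X a -> trans s a s' -> steps X r s'.
Proof. by move=> rs Xa t; apply: rt_trans rs _; apply: rt_step; exists a. Qed.

Lemma reach_trans A (s s' : state A) a :
  is_iots A -> reach A s -> trans s a s' -> reach A s'.
Proof. by move=> iA rs t; apply: steps_snoc rs (trans_act iA t) t. Qed.

Lemma reach_ind A (P : state A -> Prop) : P (start A) ->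
  (forall s a s', P s -> trans s a s' -> P s') -> forall s, reach A s -> P s.
Proof.
move=> P0 PS s rs; have {rs} := clos_rt_rtn1 _ _ _ _ rs.
by elim=> // x y [a _ t] _ Px; apply: PS Px t.
Qed.

Lemma sharedC A B : shared A B = shared B A.
Proof. exact: setUC. Qed.

Lemma composableC A B : composable A B -> composable B A.
Proof. by rewrite /composable setIC sharedC. Qed.

Lemma sync_swap A B s t a s' t' :
  trans (p := sync A B) (s, t) a (s', t') ->
  trans (p := sync B A) (t, s) a (t', s').
Proof.
rewrite /= (sharedC B A); case=> -[h1 h2 h3].
- exact: Or32.
- exact: Or31.
- exact: Or33.
Qed.

Lemma reach_swap A B s t :
  reach (sync A B) (s, t) -> reach (sync B A) (t, s).
Proof.
pose f (p : state (sync A B)) : state (sync B A) := (p.2, p.1).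
apply: (@steps_map (sync A B) (sync B A) _ _ f).
move=> -[x y] a [x' y'] ha /sync_swap h.
exists a => //; move: ha; rewrite /act /= (sharedC B A).
move=> -[[[[i|i] n]|[[i|i] n]]|[[i|i]|i]].
- by left; left; split=> //; right.
- by left; left; split=> //; left.
- by left; right; split=> //; right.
- by left; right; split=> //; left.
- by right; left; right.
- by right; left; left.
- by right; right.
Qed.

Lemma wsteps_rcons A (F : set Act) w (r s s' : state A) a :
  wsteps F w r s -> trans s a s' -> wsteps F (rcons w a) r s'.
Proof.
elim: w r => [r /= -> t|b w IH r /= [x h1 h2] t].
  by exists s' => //; exists s, s'; split=> //; apply: rt_refl.
by exists x => //; apply: IH.
Qed.

(** The last weak step of a non-empty word absorbs the extra move among its trailing [F]-actions;
    the empty word leaves no room for it, as [wsteps] is then equality. *)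
Lemma wsteps_free A (F : set Act) b w (r s s' : state A) a :
  wsteps F (b :: w) r s -> F a -> trans s a s' -> wsteps F (b :: w) r s'.
Proof.
elim: w b r => [|c w IH] b r /= [x h1 h2] Fa t; last first.
  by exists x => //; apply: IH.
rewrite -h2 in t; exists s' => //; case: h1 => [y [y' [ry ty yx]]].
by exists y, y'; split=> //; apply: steps_snoc yx Fa t.
Qed.

End Runs.

(** * One component ahead of a synchronously reachable state *)

Section Lag.
Variables (Act : Type) (A B : preiots Act).
Hypotheses (hA : is_iots A) (hB : is_iots B) (cAB : composable A B).

Local Notation freeA := (act A `\` shared A B).
Local Notation freeB := (act B `\` shared A B).

Let iAB : is_iots (sync A B) := is_iots_sync hA hB cAB.

Lemma reach_syncl r r' t a : reach (sync A B) (r, t) ->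
  freeA a -> trans r a r' -> reach (sync A B) (r', t).
Proof.
by move=> rr Fa tr; apply: (reach_trans (a := a) iAB rr); apply: Or31.
Qed.

Lemma reach_syncr r t t' b : reach (sync A B) (r, t) ->
  freeB b -> trans t b t' -> reach (sync A B) (r, t').
Proof.
by move=> rr Fb tr; apply: (reach_trans (a := b) iAB rr); apply: Or32.
Qed.

Lemma reach_sync_shared r r' t t' a : reach (sync A B) (r, t) ->
  shared A B a -> trans r a r' -> trans t a t' -> reach (sync A B) (r', t').
Proof.
by move=> rr sa tr tt; apply: (reach_trans (a := a) iAB rr); apply: Or33.
Qed.

(* [A] has run ahead of a synchronously reachable state by sending [w]. With
   [w] empty this is synchronous reachability, so the first clause of P needs
   no separate treatment. *)
Definition lag (w : seq Act) (s : state A) (t : state B) : Prop :=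
  exists2 r, reach (sync A B) (r, t) & wsteps freeA w r s.

Lemma reach_free_steps r r' t :
  reach (sync A B) (r, t) -> steps freeA r r' -> reach (sync A B) (r', t).
Proof.
move=> rr h; have {h} := clos_rt_rtn1 _ _ _ _ h.
by elim=> // x y [a Fa tr] _ rx; apply: reach_syncl rx Fa tr.
Qed.

(** For the empty word the synchronously reachable state itself moves; otherwise the move is
    absorbed after the last letter. *)
Lemma lag_free w s t a s' : lag w s t -> freeA a -> trans s a s' -> lag w s' t.
Proof.
case=> r rr; case: w => [/= <-|b w ws] Fa tr.
  by exists s' => //; apply: reach_syncl rr Fa tr.
by exists r => //; apply: wsteps_free ws Fa tr.
Qed.

Lemma lag_send w s t a s' : lag w s t -> trans s a s' -> lag (rcons w a) s' t.
Proof. by case=> r rr ws tr; exists r => //; apply: wsteps_rcons ws tr. Qed.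

(** The move of the peer is unshared, so it can already be made beside the earlier state [r]. *)
Lemma lag_peer_free w s t b t' :
  lag w s t -> freeB b -> trans t b t' -> lag w s t'.
Proof.
case=> r rr ws Fb tr; exists r => //.
exact: reach_syncr rr Fb tr.
Qed.

(** The state left behind catches up: it makes the free moves before [a], synchronises with the peer
    on [a], then makes the free moves after it. *)
Lemma lag_receive a w s t t' :
  lag (a :: w) s t -> shared A B a -> trans t a t' -> lag w s t'.
Proof.
case=> r rr [x [y [y' [ry ty yx]]] ws] sa tr; exists x => //.
apply: reach_free_steps yx.
exact: reach_sync_shared (reach_free_steps rr ry) sa ty tr.
Qed.

Lemma lag_head a w s t : lag (a :: w) s t ->
  exists2 r, reach (sync A B) (r, t) & exists r', trans r a r'.
Proof.
case=> r rr [x [y [y' [ry ty _]]] _]; exists y; last by exists y'.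
exact: reach_free_steps ry.
Qed.

End Lag.
Arguments lag {Act} A B.

(** For the empty word neither side is ahead, so the leader may be exchanged. *)
Lemma lag_nilC (Act : Type) (A B : preiots Act) s t :
  lag A B [::] s t -> lag B A [::] t s.
Proof. by case=> r /reach_swap rr /= <-; exists t. Qed.

(** * Transitions of one component with its output queue *)

Section Async.
Variables (Act : Type) (rhd : Act -> Act) (rhd_inj : injective rhd).
Variables (A B : preiots Act).
Hypotheses (hA : is_iots A) (hB : is_iots B) (hAB : async_composable rhd A B).

Local Notation MA := (out A `&` inp B).
Local Notation MB := (out B `&` inp A).

Lemma rhd_shared_fresh a :
  shared A B a -> act A (rhd a) \/ act B (rhd a) -> False.
Proof. by case: hAB => _ /disjP f sa; apply: f; exists a. Qed.

Lemma rhd_fresh : rhd @` MA `&` act A = set0.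
Proof.
apply/disjP=> _ [x [ox ix] <-] h.
by apply: (@rhd_shared_fresh x); [right|left].
Qed.

Let subMA : MA `<=` out A. Proof. by move=> a []. Qed.

Lemma shared_act a : shared A B a -> act A a /\ act B a.
Proof. by case: hAB => <-. Qed.

Lemma trans_omega (s s' : state A) q a q' :
  trans (p := omega rhd A B) (s, q) a (s', q') <->
  [\/ [/\ ~ MA a, trans s a s' & q' = q],
      exists x : set_type MA,
        [/\ a = rhd (\val x), trans s (\val x) s' & q' = rcons q x]
    | exists x : set_type MA, [/\ a = \val x, s' = s & q = x :: q']].
Proof. exact: (trans_omega_on hA subMA rhd_fresh rhd_inj). Qed.

Lemma inp_omega : inp (omega rhd A B) = inp A.
Proof. exact: (inp_omega_on hA subMA rhd_fresh). Qed.

Lemma out_omega : out (omega rhd A B) = out A.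
Proof. exact: (out_omega_on hA subMA rhd_fresh). Qed.

Lemma is_iots_omega : is_iots (omega rhd A B).
Proof. exact: (is_iots_omega_on hA subMA rhd_fresh). Qed.

Lemma omega_int_steps (s t : state A) q :
  steps (int A) s t ->
  steps (A := omega rhd A B) (int (omega rhd A B)) (s, q) (t, q).
Proof.
apply: (@steps_map _ A (omega rhd A B) _ _ (fun x => (x, q))) => x a y ia tr.
exists a; first by rewrite (int_omega_on rhd hA subMA); left.
apply/trans_omega; apply: Or31; split=> // -[oa _].
by case: hA => _ _ /disjP d _; apply: (d a).
Qed.

End Async.

Lemma async_composableC (Act : Type) (rhd : Act -> Act) (A B : preiots Act) :
  async_composable rhd A B -> async_composable rhd B A.
Proof.
by move=> [/composableC c f]; split=> //; rewrite sharedC (setUC (act B)).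
Qed.

(** * Moves of the asynchronous composition *)

Section AsyncStep.
Variables (Act : Type) (rhd : Act -> Act) (rhd_inj : injective rhd).

Lemma shared_omega (A B : preiots Act) : is_iots A -> is_iots B ->
  async_composable rhd A B ->
  shared (omega rhd A B) (omega rhd B A) = shared A B.
Proof.
move=> hA hB hAB; have hBA := async_composableC hAB.
by rewrite /shared !inp_omega // !out_omega.
Qed.

Lemma is_iots_async (A B : preiots Act) : is_iots A -> is_iots B ->
  async_composable rhd A B -> is_iots (async rhd A B).
Proof.
move=> hA hB hAB; have hBA := async_composableC hAB.
apply: is_iots_sync; try exact: is_iots_omega.
exact: composable_omega.
Qed.

(* The moves of [async rhd A B] that [A] initiates, a message of [A] counting
   as a move of [A] also when [B] consumes it. *)
Definition own_step (A B : preiots Act)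
    (p p' : state A * seq (set_type (out A `&` inp B)))
    (r r' : state B * seq (set_type (out B `&` inp A))) : Prop :=
  [\/ exists2 a, (act A `\` shared A B) a &
        [/\ trans p.1 a p'.1, p'.2 = p.2 & r' = r],
      exists2 x : set_type (out A `&` inp B), trans p.1 (\val x) p'.1 &
        p'.2 = rcons p.2 x /\ r' = r
    | exists2 x : set_type (out A `&` inp B), trans r.1 (\val x) r'.1 &
        [/\ p'.1 = p.1, p.2 = x :: p'.2 & r'.2 = r.2]].
Arguments own_step : clear implicits.

Lemma async_own_step (A B : preiots Act) : is_iots A -> is_iots B ->
  async_composable rhd A B ->
  forall p a p' r r',
  trans (p := async rhd A B) (p, r) a (p', r') ->
  own_step A B p p' r r' \/ own_step B A r r' p p'.
Proof.
move=> hA hB hAB; have hBA := async_composableC hAB.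
(* By freshness a message and its renamed copy are never both shared, so sending into a queue is
   never a synchronisation. *)
have frA x : ~ shared A B (rhd x) \/ ~ shared A B x.
  have [sx|] := pselect (shared A B x); [left|by right].
  by move/(shared_act hAB) => [h _]; apply: (rhd_shared_fresh hAB sx); left.
have shA (x : set_type (out A `&` inp B)) : shared A B (\val x).
  by right; case: (set_valP x).
have shB (x : set_type (out B `&` inp A)) : shared A B (\val x).
  by left; case: (set_valP x).
move=> [s q] a [s' q'] [t u] [t' u']; rewrite {1}/trans /= -/(omega rhd A B).
rewrite -/(omega rhd B A) shared_omega //.
move=> -[[[_ ns] h E]|[[_ ns] E h]|[sa h h']].
- case: E => -> ->; left; case/(trans_omega rhd_inj hA hAB): h => -[].
  + move=> _ tr ->; apply: Or31; exists a => //; split=> //.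
    exact: trans_act tr.
  + by move=> x [_ tr ->]; apply: Or32; exists x.
  + by move=> x [E _ _]; case: ns; rewrite E.
- case: E => -> ->; right; case/(trans_omega rhd_inj hB hBA): h => -[].
  + move=> _ tr ->; apply: Or31; exists a => //.
    by split; [exact: trans_act tr|rewrite sharedC].
  + by move=> x [_ tr ->]; apply: Or32; exists x.
  + by move=> x [E _ _]; case: ns; rewrite E.
- case/(trans_omega rhd_inj hA hAB): h =>
    [[nM tr ->]|[x [E _ _]]|[x [E -> ->]]].
  + case/(trans_omega rhd_inj hB hBA): h' =>
      [[nM' _ _]|[x [E _ _]]|[x [E -> ->]]].
    * by case: sa => -[i o]; [case: nM'|case: nM].
    * by case: (frA (\val x)) => // -[]; rewrite -E.
    * by right; apply: Or33; exists x; rewrite // -E.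
  + by case: (frA (\val x)) => // -[]; rewrite -E.
  + case/(trans_omega rhd_inj hB hBA): h' =>
      [[_ tr ->]|[y [E' _ _]]|[y [E' _ _]]].
    * by left; apply: Or33; exists x; rewrite // -E.
    * by case: (frA (\val y)) => // -[]; rewrite -E'.
    (* Deliveries from both queues cannot synchronise: the message would be both an output and an
       input of [A]. *)
    * have [oA _] := set_valP x; have [_ iA] := set_valP y.
      case: hA => /disjP d _ _ _; case: (d a); first by rewrite E'.
      by rewrite E.
Qed.

(** The label is the free action itself, [rhd (\val x)] for sending [x], and [\val x] for its
    delivery; hiding it lets runs be built without tracking names. *)
Lemma own_step_async (A B : preiots Act) : is_iots A -> is_iots B ->
  async_composable rhd A B ->
  forall p p' r r', own_step A B p p' r r' ->
  exists a, trans (p := async rhd A B) (p, r) a (p', r').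
Proof.
move=> hA hB hAB; have hBA := async_composableC hAB.
have iOA : is_iots (omega rhd A B) by exact: is_iots_omega.
move=> [s q] [s' q'] [t u] [t' u'] h.
have free a w : trans (p := omega rhd A B) (s, q) a (s', w) ->
    ~ shared A B a ->
    exists a, trans (p := async rhd A B) ((s, q), (t, u)) a ((s', w), (t, u)).
  move=> tr ns; exists a; apply: Or31; split=> //.
  by rewrite shared_omega //; split=> //; apply: trans_act tr.
case: h =>
  [[a [_ ns] /= [tr -> [-> ->]]]|[x /= tr [-> [-> ->]]]|[x /= tr [-> -> ->]]].
- apply: (free a) => //; apply/trans_omega => //; apply: Or31; split=> //.
  by case=> oa ib; apply: ns; right.
- apply: (free (rhd (\val x))) => //.
    by apply/trans_omega => //; apply: Or32; exists x.
  move=> /(shared_act hAB) [aA _]; apply: (rhd_shared_fresh hAB (a := \val x)).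
    by right; case: (set_valP x).
  by left.
- exists (\val x); have [oA iB] := set_valP x; apply: Or33; split.
  + by rewrite shared_omega //; right.
  + by apply/trans_omega => //; apply: Or33; exists x.
  + apply/trans_omega => //; apply: Or31; split=> // -[oB _].
    by case: hB => /disjP d _ _ _; apply: (d (\val x)).
Qed.

Lemma reach_own_step (A B : preiots Act) : is_iots A -> is_iots B ->
  async_composable rhd A B ->
  forall p p' r r', reach (async rhd A B) (p, r) ->
  own_step A B p p' r r' \/ own_step B A r r' p p' ->
  reach (async rhd A B) (p', r').
Proof.
move=> hA hB hAB p p' r r' rr; have hBA := async_composableC hAB.
case=> /own_step_async [] // a tr.
  by apply: reach_trans rr tr; apply: is_iots_async.
by apply: (reach_trans _ rr (sync_swap tr)); apply: is_iots_async.
Qed.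

(** A synchronisation is simulated by sending the message and delivering it at once, which leaves
    both queues empty. *)
Lemma sync_reach_async (A B : preiots Act) : is_iots A -> is_iots B ->
  async_composable rhd A B ->
  forall s t, reach (sync A B) (s, t) ->
  reach (async rhd A B) ((s, [::]), (t, [::])).
Proof.
move=> hA hB hAB s t; have step := reach_own_step hA hB hAB.
apply: (@reach_ind _ (sync A B)
  (fun p => reach (async rhd A B) ((p.1, [::]), (p.2, [::])))).
  exact: rt_refl.
move=> [x y] a [x' y'] rr /= [] [/= ha h1 h2].
- by apply: step rr _; left; apply: Or31; exists a; rewrite //= h2.
- by apply: step rr _; right; apply: Or31; exists a; rewrite ?(sharedC B A) //= h1.
- case: ha => -[i o].
  + pose z : set_type (out B `&` inp A) := SigSub (mem_set (conj o i)).
    have rr' : reach (async rhd A B) ((x, [::]), (y', [:: z])).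
      by apply: step rr _; right; apply: Or32; exists z.
    by apply: step rr' _; right; apply: Or33; exists z.
  + pose z : set_type (out A `&` inp B) := SigSub (mem_set (conj o i)).
    have rr' : reach (async rhd A B) ((x', [:: z]), (y, [::])).
      by apply: step rr _; left; apply: Or32; exists z.
    by apply: step rr' _; left; apply: Or33; exists z.
Qed.

(** * Half-duplex communication excludes competing outputs *)

Lemma half_duplex_no_mixed (A B : preiots Act) : is_iots A -> is_iots B ->
  async_composable rhd A B -> half_duplex rhd A B -> no_mixed_outputs A B.
Proof.
move=> hA hB hAB hd s t rr a s' b t' ta tb.
have [Ma|] := pselect ((out A `&` inp B) a); [right=> Mb|by left].
have step := reach_own_step hA hB hAB.
pose x : set_type (out A `&` inp B) := SigSub (mem_set Ma).
pose y : set_type (out B `&` inp A) := SigSub (mem_set Mb).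
have r1 : reach (async rhd A B) ((s', [:: x]), (t, [::])).
  by apply: step (sync_reach_async hA hB hAB rr) _; left; apply: Or32; exists x.
have r2 : reach (async rhd A B) ((s', [:: x]), (t', [:: y])).
  by apply: step r1 _; right; apply: Or32; exists y.
by case: (hd _ _ _ _ r2).
Qed.

(** * Condition (3) implies P *)

Definition one_lags (A B : preiots Act)
    (p : state A * seq (set_type (out A `&` inp B)))
    (r : state B * seq (set_type (out B `&` inp A))) : Prop :=
  (r.2 = [::] /\ lag A B (map \val p.2) p.1 r.1) \/
  (p.2 = [::] /\ lag B A (map \val r.2) r.1 p.1).
Arguments one_lags : clear implicits.

Lemma one_lagsC (A B : preiots Act) p r : one_lags A B p r -> one_lags B A r p.
Proof. by case; [right|left]. Qed.

Lemma no_mixed_outputsC (A B : preiots Act) :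
  no_mixed_outputs A B -> no_mixed_outputs B A.
Proof.
move=> nm t s /reach_swap rr b t' a s' tb ta.
by case: (nm _ _ rr _ _ _ _ ta tb); [right|left].
Qed.

(** When [A] leads, its free moves, sends and deliveries keep, extend and shorten the word by which
    it leads. When [B] leads, the queue of [A] is empty: a free move is made beside the earlier
    state, there is nothing to deliver, and a send forces the queue of [B] to be empty. *)
Lemma one_lags_own_step (A B : preiots Act) : is_iots A -> is_iots B ->
  composable A B -> no_mixed_outputs A B ->
  forall p p' r r', one_lags A B p r -> own_step A B p p' r r' ->
  one_lags A B p' r'.
Proof.
move=> hA hB cAB nm [s q] [s' q'] [t u] [t' u']; have cBA := composableC cAB.
case=> /= -[-> L] h.
- left; case: h =>
    [[a Fa /= [tr -> [-> ->]]]|[x /= tr [-> [-> ->]]]|[x /= tr [-> E ->]]].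
  + by split=> //; apply: lag_free L Fa tr.
  + by split=> //; rewrite map_rcons; apply: lag_send L tr.
  + rewrite E in L; split=> //; apply: lag_receive L _ tr => //.
    by right; case: (set_valP x).
- case: h =>
    [[a Fa /= [tr -> [-> ->]]]|[x /= tr [-> [-> ->]]]|[x /= tr [_ E _]]] //.
  + right; split=> //; rewrite sharedC in Fa.
    exact: lag_peer_free L Fa tr.
  (* With both queues empty the lead passes to [A]. *)
  + case: u L => [L|y u L].
      by left; split=> //; apply: (lag_send (lag_nilC L)) tr.
    (* At the state [z] where [B] is about to send [y], [A] in state [s] could also send [x],
       against condition (3). *)
    have [z rz [z' tz]] := lag_head hB hA cBA L.
    by case: (nm _ _ (reach_swap rz) _ _ _ _ tr tz) => -[]; apply: set_valP.
Qed.

(** With an empty word [lag] is synchronous reachability, so the clause of P for two empty queues is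
    an instance of either disjunct of [one_lags]. *)
Lemma propertyP_lags (A B : preiots Act) : propertyP rhd A B <->
  forall p r, reach (async rhd A B) (p, r) -> one_lags A B p r.
Proof.
split=> [P [s q] [t u] /P
         [[-> -> rr]|[_ -> [r rr w]]|[-> _ [r rr w]]]|L s q t u /L].
- by left; split=> //; exists s.
- by left; split=> //; exists r.
- right; split=> //; exists r; first exact: reach_swap.
  by rewrite sharedC.
case=> /= -[-> [r rr]].
  case: q => [/= <-|x q w]; first exact: Or31.
  by apply: Or32; split=> //; exists r.
case: u => [/= <-|x u w]; first by apply: Or31; split=> //; apply: reach_swap.
apply: Or33; split=> //; exists r; first exact: reach_swap.
by rewrite sharedC.
Qed.

Lemma no_mixed_propertyP (A B : preiots Act) : is_iots A -> is_iots B ->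
  async_composable rhd A B -> no_mixed_outputs A B -> propertyP rhd A B.
Proof.
move=> hA hB hAB nm; apply/propertyP_lags => p0 r0.
have [cAB _] := hAB; have cBA := composableC cAB.
apply: (@reach_ind _ (async rhd A B)
  (fun p => one_lags A B p.1 p.2) _ _ (p0, r0)).
  by left; split=> //; exists (start A) => //; apply: rt_refl.
move=> [p r] a [p' r'] /= L /(async_own_step hA hB hAB) [] h.
  exact: one_lags_own_step L h.
(* Moves of [B] reduce to those of [A] by exchanging the components. *)
apply: one_lagsC; apply: one_lags_own_step (one_lagsC L) h => //.
exact: no_mixed_outputsC.
Qed.

(** * Transfer of compatibility under P *)

Lemma propertyPC (A B : preiots Act) :
  propertyP rhd A B -> propertyP rhd B A.
Proof.
move=> /propertyP_lags L; apply/propertyP_lags => p r /reach_swap rr.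
exact/one_lagsC/L.
Qed.

(** Sends of [A] carry fresh names, so [omega rhd A B] can offer [a] only by delivering the head of
    its queue. Then [A] is the component ahead, and just before sending that head it was in a state
    synchronously reachable together with [t]. *)
Lemma offered_sync (A B : preiots Act) : is_iots A -> is_iots B ->
  async_composable rhd A B -> propertyP rhd A B ->
  forall s q t u a p, reach (async rhd A B) ((s, q), (t, u)) ->
  (out A `&` inp B) a -> trans (p := omega rhd A B) (s, q) a p ->
  exists2 r, reach (sync A B) (r, t) & exists r', trans r a r'.
Proof.
move=> hA hB hAB /propertyP_lags L s q t u a [s' q'] /L h [oa ib].
have [cAB _] := hAB.
have sa : shared A B a by right.
case/trans_omega => // [[[]//]|[x [E _ _]]|[x [-> _ E]]].
  case: (@rhd_shared_fresh _ _ _ _ hAB (\val x)).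
    by right; case: (set_valP x).
  by rewrite -E; left; left; right.
rewrite E in h; case: h => -[/= // _ L']; exact: lag_head L'.
Qed.

(** An input of [B] is not one of its outputs, so it is not renamed and the queue of [B] stays as it
    is. *)
Lemma omega_receive (A B : preiots Act) : is_iots A -> is_iots B ->
  async_composable rhd A B ->
  forall (t : state B) u a (t' : state B), (out A `&` inp B) a -> trans t a t' ->
  trans (p := omega rhd B A) (t, u) a (t', u).
Proof.
move=> hA hB hAB t u a t' [_ ib] tr; have hBA := async_composableC hAB.
apply/trans_omega => //; apply: Or31; split=> // -[ob _].
by case: hB => /disjP d _ _ _; apply: (d a).
Qed.

End AsyncStep.

Theorem theorem4p3 (Act : Type) (rhd : Act -> Act) (rhd_inj : injective rhd)
    (A B : preiots Act) (hA : is_iots A) (hB : is_iots B)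
    (hAB : async_composable rhd A B)
    (h : [\/ propertyP rhd A B, half_duplex rhd A B | no_mixed_outputs A B]) :
  (strongly_sync_compatible A B -> strongly_async_compatible rhd A B) /\
  (weakly_sync_compatible A B -> weakly_async_compatible rhd A B).
Proof.
have hBA := async_composableC hAB.
have P : propertyP rhd A B.
  case: h => [//|/(half_duplex_no_mixed rhd_inj hA hB hAB)|] nm;
  exact: no_mixed_propertyP.
have PC := propertyPC P.
have cO := composable_omega rhd_inj hA hB hAB.
have offA := offered_sync rhd_inj hA hB hAB P.
have offB := offered_sync rhd_inj hB hA hBA PC.
have recA := omega_receive rhd_inj hA hB hAB.
have recB := omega_receive rhd_inj hB hA hBA.
split=> -[_ C]; split=> //; split=> // -[s q] [t u] rr;
  rewrite !out_omega // !inp_omega //; split=> a Ma [p tr].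
(* The receiver is in the same state [t] in both compositions, so its answer to the earlier sender
   state [r] serves here as well. *)
- have [r rs tr'] := offA _ _ _ _ _ _ rr Ma tr.
  have [t' tt] := (C _ _ rs).1 a Ma tr'.
  by exists (t', u); apply: recA.
- have [r rs tr'] := offB _ _ _ _ _ _ (reach_swap rr) Ma tr.
  have [s' ts] := (C _ _ (reach_swap rs)).2 a Ma tr'.
  by exists (s', q); apply: recB.
- have [r rs tr'] := offA _ _ _ _ _ _ rr Ma tr.
  have [t1 [t' [st tt]]] := (C _ _ rs).1 a Ma tr'.
  (* The internal moves of [B] lift with its queue [u] unchanged. *)
  exists (t1, u), (t', u); split; last exact: recA.
  exact: omega_int_steps.
- have [r rs tr'] := offB _ _ _ _ _ _ (reach_swap rr) Ma tr.
  have [s1 [s' [st ts]]] := (C _ _ (reach_swap rs)).2 a Ma tr'.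
  exists (s1, q), (s', q); split; last exact: recB.
  exact: omega_int_steps.
Qed.
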